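(* Let $p$ be an odd prime, $n\ge 1$ and let $m$ be an integer with $1\le m\le p^{n-1}$. For all $i=1,\dots,n$, $$\xi_m\cap\mathfrak{B}_i=Z_m(\mathfrak{L}_n)\cap\mathfrak{B}_i=\mathfrak{L}_n^{p^{n-1}-m+1}\cap\mathfrak{B}_i .$$ In particular, $\xi_m=Z_m(\mathfrak{L}_n)=\mathfrak{L}_n^{p^{n-1}-m+1}$.
   Context: Let $p$ be an odd prime and $n\ge 1$. $\mathfrak{L}_n$ is the Lie algebra over $\mathbb{F}_p$ with basis $\mathfrak{B}=\bigcup_{k=1}^n\mathfrak{B}_k$, where $\mathfrak{B}_k=\{x^\Lambda\partial_k\mid x^\Lambda=x_1^{\lambda_1}\cdots x_{k-1}^{\lambda_{k-1}},\ 0\le\lambda_i\le p-1\}$, viewed as a subalgebra of the Witt algebra of derivations of the truncated polynomial ring $\mathbb{F}_p[x_1,\dots,x_n]/(x_1^p,\dots,x_n^p)$, with $[x^\Lambda\partial_k,x^\Theta\partial_j]=\partial_j(x^\Lambda)x^\Theta\partial_k-x^\Lambda\partial_k(x^\Theta)\partial_j$ (products of monomials in which some exponent reaches $p$ are zero). Its Lie powers are $\mathfrak{L}_n^1=\mathfrak{L}_n$, $\mathfrak{L}_n^{i+1}=[\mathfrak{L}_n^i,\mathfrak{L}_n]$, and $Z_m(\mathfrak{L}_n)$ is the $m$-th term of its upper central series ($Z_0=0$, $Z_{m+1}/Z_m$ is the center of $\mathfrak{L}_n/Z_m$). The $p$-degree of a basis element is $\mathrm{pdeg}(x^\Lambda\partial_k)=\sum_{i=1}^{k-1}\lambda_ip^{i-1}+\mu_k$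 with $\mu_k=p^{n-1}-p^{k-1}$. $\xi_m$ denotes the $\mathbb{F}_p$-span of all $x^\Lambda\partial_k\in\mathfrak{B}$ (any $1\le k\le n$) with $\mathrm{pdeg}(x^\Lambda\partial_k)<m$. *)

(* Defs.v *)
From mathcomp Require Import all_boot all_order all_algebra.

Set Implicit Arguments.
Unset Strict Implicit.
Unset Printing Implicit Defensive.

Import GRing.Theory.
Local Open Scope ring_scope.

(* Indices are zero-based: k : 'I_n stands for the variable x_(k+1) and for the
   partial derivative d/dx_(k+1).  Everything is meant for p prime. *)

Section TruncatedPolynomials.
Variables p n : nat.

(* Exponent vectors of the monomials x^A with all exponents at most p - 1. *)
Definition monom := {ffun 'I_n -> 'I_p}.

(* F_p[x_1, ..., x_n] / (x_1^p, ..., x_n^p), as coefficient functions on the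
   basis of monomials; ('F_p)^o makes this a vector space over 'F_p. *)
Definition tpoly := {ffun monom -> ('F_p)^o}.

Definition tmono (A : monom) : tpoly := [ffun C => (C == A)%:R].

(* Exponents are added in nat, so pairs of monomials whose product has an
   exponent reaching p contribute to no coefficient. *)
Definition tmul (f g : tpoly) : tpoly :=
  [ffun C : monom =>
     \sum_(A : monom) \sum_(B : monom | [forall i, A i + B i == C i :> nat]%N)
       (f A : 'F_p) * (g B : 'F_p)].

Definition tderiv (k : 'I_n) (f : tpoly) : tpoly :=
  [ffun C : monom =>
     \sum_(A : monom | [forall i, A i == C i + (i == k) :> nat]%N)
       (A k)%:R * (f A : 'F_p)].

(* The Witt algebra: u stands for the derivation \sum_k u_k d/dx_k. *)
Definition witt := {ffun 'I_n -> tpoly}.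

Definition dterm (f : tpoly) (k : 'I_n) : witt :=
  [ffun i => if i == k then f else 0].

(* Bilinear extension of [f d_k, g d_j] = d_j(f) g d_k - f d_k(g) d_j
   (see bracket_dterm). *)
Definition bracket (u v : witt) : witt :=
  [ffun i => \sum_(l : 'I_n)
     (tmul (tderiv l (u i)) (v l) - tmul (u l) (tderiv l (v i)))].

Definition spanset (S : {set witt}) : {set witt} :=
  [set u : witt | u \in <<enum S>>%VS].

Definition lieprod (U V : {set witt}) : {set witt} :=
  spanset [set bracket u v | u in U, v in V].

(* x^A involves only the variables x_1, ..., x_k preceding x_(k+1). *)
Definition admissible (k : 'I_n) (A : monom) : bool :=
  [forall i : 'I_n, (k <= i)%N ==> (A i == 0 :> nat)].

Definition basis_part (k : 'I_n) : {set witt} :=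
  [set dterm (tmono A) k | A : monom & admissible k A].

Definition lieL : {set witt} := spanset (\bigcup_(k : 'I_n) basis_part k).

(* lie_power i is L^i for i >= 1, with L^1 = L; the value at i = 0 is junk. *)
Definition lie_power (i : nat) : {set witt} :=
  iter i.-1 (fun U => lieprod U lieL) lieL.

(* u + Z_m is central in L / Z_m iff [u, v] is in Z_m for all v in L. *)
Fixpoint upper_central (m : nat) : {set witt} :=
  if m is m'.+1 then
    [set u in lieL | [forall v in lieL, bracket u v \in upper_central m']]
  else [set (0 : witt)].

Definition pdeg (A : monom) (k : 'I_n) : nat :=
  (\sum_(i < n | (i < k)%N) A i * p ^ i + (p ^ n.-1 - p ^ k))%N.

Definition xi (m : nat) : {set witt} :=
  spanset (\bigcup_(k : 'I_n)
    [set dterm (tmono A) k | A : monom & admissible k A && (pdeg A k < m)%N]).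

Lemma tmul_mono (A B C : monom) :
  (forall i, (A i + B i = C i)%N) -> tmul (tmono A) (tmono B) = tmono C.
Proof.
move=> ABC; apply/ffunP=> D; rewrite !ffunE (bigD1 A) //= [X in _ + X]big1.
  rewrite addr0 big_mkcond (bigD1 B) //= [X in _ + X]big1.
    rewrite !ffunE !eqxx mulr1 addr0.
    have -> : [forall i, A i + B i == D i :> nat]%N = (D == C).
      apply/forallP/eqP => [AD | -> i]; last by rewrite ABC.
      by apply/ffunP=> i; apply/val_inj; rewrite /= -ABC (eqP (AD i)).
    by case: (D == C).
  by move=> E EB; rewrite !ffunE (negPf EB) mulr0 if_same.
by move=> E EA; rewrite big1 // => F _; rewrite !ffunE (negPf EA) mul0r.
Qed.

Lemma tmul_mono0 (A B : monom) i :
  (p <= A i + B i)%N -> tmul (tmono A) (tmono B) = 0.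
Proof.
move=> ABp; apply/ffunP=> D; rewrite !ffunE big1 // => E _.
rewrite big1 // => F /forallP/(_ i)/eqP EF.
rewrite !ffunE; case: eqP => [EA|]; last by rewrite mul0r.
case: eqP => [FB|]; last by rewrite mulr0.
by move: ABp; rewrite -EA -FB EF leqNgt ltn_ord.
Qed.

Lemma tderiv_mono (k : 'I_n) (A C : monom) :
  (forall i, (A i = C i + (i == k) :> nat)%N) ->
  tderiv k (tmono A) = (A k)%:R *: tmono C.
Proof.
move=> AC; apply/ffunP=> D; rewrite !ffunE big_mkcond (bigD1 A) //= [X in _ + X]big1.
  rewrite !ffunE eqxx addr0.
  have -> : [forall i, A i == D i + (i == k) :> nat]%N = (D == C).
    apply/forallP/eqP => [AD | -> i]; last by rewrite AC.
    apply/ffunP=> i; apply/val_inj; apply/eqP.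
    by rewrite /= -(eqn_add2r (i == k)) -(eqP (AD i)) AC.
  by case: (D == C) => //; symmetry; apply: mulr0.
by move=> E EA; rewrite !ffunE (negPf EA) mulr0 if_same.
Qed.

Lemma tderiv_mono0 (k : 'I_n) (A : monom) :
  A k = 0 :> nat -> tderiv k (tmono A) = 0.
Proof.
move=> A0; apply/ffunP=> D; rewrite !ffunE big1 // => E /forallP/(_ k)/eqP.
rewrite eqxx addn1 => Ek; rewrite !ffunE; case: eqP => [EA|]; last by rewrite mulr0.
by move: Ek; rewrite EA A0.
Qed.

Lemma tmul0l f : tmul 0 f = 0.
Proof.
by apply/ffunP=> C; rewrite !ffunE big1 // => A _; rewrite big1 // => B _;
  rewrite ffunE mul0r.
Qed.

Lemma tmul0r f : tmul f 0 = 0.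
Proof.
by apply/ffunP=> C; rewrite !ffunE big1 // => A _; rewrite big1 // => B _;
  rewrite ffunE mulr0.
Qed.

Lemma tderiv0 k : tderiv k 0 = 0.
Proof.
by apply/ffunP=> C; rewrite !ffunE big1 // => A _; rewrite ffunE mulr0.
Qed.

Lemma bracket_dterm (f g : tpoly) (k j : 'I_n) :
  bracket (dterm f k) (dterm g j) =
    dterm (tmul (tderiv j f) g) k - dterm (tmul f (tderiv k g)) j.
Proof.
apply/ffunP=> i; rewrite [LHS]ffunE sumrB.
have -> : (dterm (tmul (tderiv j f) g) k - dterm (tmul f (tderiv k g)) j) i =
    dterm (tmul (tderiv j f) g) k i - dterm (tmul f (tderiv k g)) j i.
  by rewrite ffunE [X in _ + X]ffunE.
congr (_ - _).
  rewrite (bigD1 j) //= big1 => [|l /negPf lj].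
    rewrite addr0 /dterm [X in tderiv j X]ffunE [X in tmul _ X]ffunE [RHS]ffunE eqxx.
    by case: eqP => // _; rewrite tderiv0 tmul0l.
  by rewrite [dterm g j l]ffunE lj tmul0r.
rewrite (bigD1 k) //= big1 => [|l /negPf lk].
  rewrite addr0 /dterm [X in tderiv k X]ffunE [X in tmul X _]ffunE [RHS]ffunE eqxx.
  by case: eqP => // _; rewrite tderiv0 tmul0r.
by rewrite [dterm f k l]ffunE lk tmul0l.
Qed.

End TruncatedPolynomials.

(* Main.v *)
Require Import Defs.
From mathcomp Require Import all_boot all_order all_algebra.
From mathcomp Require Import zify.

(** Read the exponents of x^A as the base p digits of a number v(A), and give
    x^A d_k, with k counted from 0, the weight p^k - v(A).  An admissible
    monomial x^A involves only x_0, ..., x_(k-1), so v(A) < p^k and the weight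
    lies between 1 and N = p^(n-1); it equals N minus the p-degree.  For l < k
    the bracket [x^A d_k, x^B d_l] is a multiple of x^(A - e_l + B) d_k, and
    v(A - e_l + B) = v(A) - p^l + v(B).  Hence the weight of a bracket is the
    sum of the weights of its factors ([weight_bracket]): the weight grades
    the Lie algebra.

    Let F_a be the span of the basis elements of weight at least a ([filt]).
    Then xi_m = F_(N-m+1) merely rewrites the definition ([xi_filt]), and the
    grading gives [F_a, F_b] inside F_(a+b) ([bracket_filt]).  What remains is
    that the elements of weight 1 move everything by exactly one step.  These
    elements are v_j = x^M d_j, where M has all its digits below j equal to
    p - 1.

    Lower central series.  If x^C d_k has weight at least 2, then v(C) + 1 is
    still below p^k.  Adding 1 to v(C) resets a run of digits p - 1 to 0 and
    raises the next digit, say the j-th; calling A the result, [x^A d_k, v_j]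
    is A_j x^C d_k, where 0 < A_j < p ([raise_monom]).  So [F_a, F_1] = F_(a+1)
    for a >= 1, and the i-th Lie power is F_i.

    Upper central series.  Let u have a nonzero coefficient at some x^A d_k of
    weight w < N.  If A is not 0, with first nonzero digit the j-th,
    subtracting 1 from v(A) borrows through the zeros below j, and the
    coefficient of [u, v_j] at the resulting monomial of weight w + 1 comes
    from x^A d_k alone ([lower_monom], [coef_bracket_lower]).  If A = 0, then
    w = p^k < N forces k < n - 1, and bracketing with v_(n-1) detects d_k
    ([coef_bracket_upper]).  So [u, F_1] lies in F_(a+1), with a at most N,
    only if u lies in F_a ([filt_centralizer]), and induction on m gives
    Z_m = F_(N-m+1). *)

Set Implicit Arguments.
Unset Strict Implicit.
Unset Printing Implicit Defensive.

Import GRing.Theory.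
Local Open Scope ring_scope.

(** * Coefficients of Witt algebra elements *)

Section Coefficients.
Variables p n : nat.
Implicit Types (A B C D M : monom p n) (i j k l : 'I_n) (u v : witt p n).
Implicit Types (f g : tpoly p n) (c : 'F_p).

(** A named projection onto 'F_p: rewriting with it avoids unification between
    the nested finite functions and the alias ('F_p)^o that u k A unfolds to. *)
Definition coef u k A : 'F_p := u k A.

Lemma coef_sum I r (P : pred I) (F : I -> witt p n) k A :
  coef (\sum_(i <- r | P i) F i) k A = \sum_(i <- r | P i) coef (F i) k A.
Proof.
apply: (big_morph (fun u => coef u k A)) => [u v|]; rewrite /coef; last by rewrite 2!ffunE.
by rewrite [(u + v) k]ffunE [LHS]ffunE.
Qed.

Lemma coef_scale c u k A : coef (c *: u) k A = c * coef u k A.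
Proof. by rewrite /coef [(c *: u) k]ffunE [LHS]ffunE. Qed.

Lemma coef_dterm A k l B :
  coef (dterm (tmono A) k) l B = ((l == k) && (B == A))%:R.
Proof.
by rewrite /coef [dterm _ _ l]ffunE; case: eqP => _; rewrite [LHS]ffunE.
Qed.

Lemma coef_bracket u v k C :
  coef (bracket u v) k C =
    \sum_l ((tmul (tderiv l (u k)) (v l) C : 'F_p) -
            (tmul (u l) (tderiv l (v k)) C : 'F_p)).
Proof.
rewrite /coef /bracket [X in fun_of_fin X C]ffunE sum_ffunE.
by apply: eq_bigr => l _; rewrite [LHS]ffunE [X in _ + X]ffunE.
Qed.

Lemma coef_mono_comb (c : 'I_n -> monom p n -> 'F_p) k A :
  coef (\sum_l \sum_B c l B *: dterm (tmono B) l) k A = c k A.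
Proof.
transitivity (\sum_l \sum_B c l B * ((k == l) && (A == B))%:R).
  rewrite coef_sum; apply: eq_bigr => l _; rewrite coef_sum.
  by apply: eq_bigr => B _; rewrite coef_scale coef_dterm.
rewrite (bigD1 k isT) /= (bigD1 A isT) /= !eqxx mulr1.
rewrite !big1 ?addr0 // => [l /negPf lk | B /negPf BA].
  by rewrite big1 // => B _; rewrite eq_sym lk mulr0.
by rewrite eq_sym BA mulr0.
Qed.

Lemma witt_expand u :
  u = \sum_k \sum_A coef u k A *: dterm (tmono A) k.
Proof. by apply/ffunP=> k; apply/ffunP=> A; symmetry; apply: coef_mono_comb. Qed.

(** Distinct pairs (k, A) give distinct vectors dterm (tmono A) k, which form a
    basis of the whole Witt algebra; so a span of some of them is cut out by
    the vanishing of the other coefficients. *)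
Lemma mem_spanset_monoP (P : 'I_n -> pred (monom p n)) u :
  reflect (forall k A, coef u k A != 0 -> P k A)
    (u \in spanset (\bigcup_(k : 'I_n) [set dterm (tmono A) k | A : monom p n & P k A])).
Proof.
set S := \bigcup_k _; apply: (iffP idP) => [|uP]; rewrite inE.
  move=> uS k A; apply: contraNT => nPA; apply/eqP.
  rewrite (coord_span (X := in_tuple (enum S)) uS) coef_sum big1 // => i _.
  have: (in_tuple (enum S))`_i \in enum S by apply: mem_nth.
  rewrite mem_enum => /bigcupP[l _ /imsetP[B]]; rewrite inE => PB ->.
  rewrite coef_scale coef_dterm; case: (k =P l) => [kl|_]; last exact: mulr0.
  case: eqP => [AB|_]; last exact: mulr0.
  by rewrite kl AB PB in nPA.
rewrite [u]witt_expand; apply: rpred_sum => k _; apply: rpred_sum => A _.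
have [->|/uP PA] := eqVneq (coef u k A) 0; first by rewrite scale0r mem0v.
apply/memvZ/memv_span; rewrite mem_enum; apply/bigcupP; exists k => //.
by apply: imset_f; rewrite inE.
Qed.

(** This and [tderiv_neq0] locate the monomials responsible for a nonzero
    coefficient, so that the support of a bracket can be bounded without
    expanding the bracket bilinearly. *)
Lemma tmul_neq0 f g C : tmul f g C != 0 ->
  exists A B, [/\ forall i, (A i + B i = C i)%N, f A != 0 & g B != 0].
Proof.
rewrite [tmul f g C]ffunE => nz.
have [A nzA] : exists A : monom p n,
    \sum_(B : monom p n | [forall i, A i + B i == C i :> nat]%N)
       ((f A : 'F_p) * (g B : 'F_p)) != 0.
  apply/existsP; apply: contraNT nz; rewrite negb_exists => /forallP z.
  by rewrite big1 // => A _; apply/eqP/negPn/z.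
have [B /forallP ABC nzB] : exists2 B : monom p n, [forall i, A i + B i == C i :> nat]%N &
       (f A : 'F_p) * (g B : 'F_p) != 0.
  apply/exists_inP; apply: contraNT nzA => /exists_inPn z.
  by rewrite big1 // => B /z/negPn/eqP.
move: nzB; rewrite mulf_eq0 => /norP[fA gB].
by exists A, B; split=> // i; apply/eqP.
Qed.

Lemma tderiv_neq0 k f C : tderiv k f C != 0 ->
  exists A, (forall i, A i = C i + (i == k) :> nat)%N /\ f A != 0.
Proof.
rewrite [tderiv k f C]ffunE => nz.
have [A /forallP AC nzA] : exists2 A : monom p n, [forall i, A i == C i + (i == k) :> nat]%N &
       (A k)%:R * (f A : 'F_p) != 0.
  apply/exists_inP; apply: contraNT nz => /exists_inPn z.
  by rewrite big1 // => A /z/negPn/eqP.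
move: nzA; rewrite mulf_eq0 => /norP[_ fA].
by exists A; split=> // i; apply/eqP.
Qed.

Lemma tmul_mono_coef f M D C : (forall i, D i + M i = C i)%N ->
  tmul f (tmono M) C = f D.
Proof.
move=> DMC; rewrite [LHS]ffunE (bigD1 D) //= (bigD1 M) /=; last first.
  by apply/forallP=> i; rewrite DMC.
rewrite [tmono M M]ffunE eqxx mulr1 !big1 ?addr0 // => [A AD|B /andP[_ BM]].
  rewrite big1 // => B /forallP ABC.
  rewrite [tmono M B]ffunE; case: eqP => [BM|_]; last exact: mulr0.
  case/eqP: AD; apply/ffunP=> i; apply/val_inj/eqP.
  by rewrite /= -(eqn_add2r (M i)) DMC -BM.
by rewrite [tmono M B]ffunE (negPf BM) mulr0.
Qed.

Lemma tderiv_coef k f A D : (forall i, A i = D i + (i == k) :> nat)%N ->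
  tderiv k f D = (A k)%:R * (f A : 'F_p) :> 'F_p.
Proof.
move=> AD; rewrite [LHS]ffunE (bigD1 A) /=; last by apply/forallP=> i; rewrite AD.
rewrite big1 ?addr0 // => B /andP[/forallP BD /eqP[]].
by apply/ffunP=> i; apply/val_inj; rewrite /= (eqP (BD i)) AD.
Qed.

Lemma tmulE f g C : tmul f g C =
  \sum_(A : monom p n) \sum_(B : monom p n | [forall i, A i + B i == C i :> nat]%N)
     (f A : 'F_p) * (g B : 'F_p) :> 'F_p.
Proof. exact: ffunE. Qed.

Lemma tpoly_scaleE c f A : (c *: f) A = c * (f A : 'F_p) :> 'F_p.
Proof. exact: ffunE. Qed.

Lemma tmul_scalel c f g : tmul (c *: f) g = c *: tmul f g.
Proof.
apply/ffunP=> C; rewrite [LHS]tmulE [RHS]tpoly_scaleE tmulE mulr_sumr.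
apply: eq_bigr => A _; rewrite mulr_sumr; apply: eq_bigr => B _.
by rewrite tpoly_scaleE mulrA.
Qed.

Lemma tmul_scaler c f g : tmul f (c *: g) = c *: tmul f g.
Proof.
apply/ffunP=> C; rewrite [LHS]tmulE [RHS]tpoly_scaleE tmulE mulr_sumr.
apply: eq_bigr => A _; rewrite mulr_sumr; apply: eq_bigr => B _.
by rewrite tpoly_scaleE mulrCA.
Qed.

Lemma dtermE f k i : dterm f k i = if i == k then f else 0.
Proof. exact: ffunE. Qed.

Lemma dterm_scale c f k : dterm (c *: f) k = c *: dterm f k.
Proof.
apply/ffunP=> i; rewrite [RHS]ffunE !dtermE.
by case: ifP => // _; rewrite scaler0.
Qed.

End Coefficients.

Local Close Scope ring_scope.

(** * The weight of a basis element *)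

Section Weights.
Variables p n : nat.
Implicit Types (A B C D M : monom p n) (i j k l : 'I_n).

(** The number whose base p digits are the exponents of A, that of x_0 being the
    least significant. *)
Definition digit_value A := \sum_i A i * p ^ i.
Definition weight k A := p ^ k - digit_value A.

(** M is the exponent of the only basis element of the form x^M d_j that has
    weight 1; p - 1 is its digit below j, since v(M) = p^j - 1. *)
Definition top_monom j M := forall i, M i = (if i < j then p.-1 else 0) :> nat.

Lemma monom_of_digits (f : 'I_n -> nat) :
  (forall i, f i < p) -> exists A, forall i, A i = f i :> nat.
Proof.
by move=> fp; exists [ffun i => Ordinal (fp i)] => i; rewrite ffunE.
Qed.

Lemma admissibleP k A :
  reflect (forall i, k <= i -> A i = 0 :> nat) (admissible k A).
Proof.
apply: (iffP forallP) => h i; first by move=> ki; apply/eqP/(implyP (h i)).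
by apply/implyP=> /h ->.
Qed.

Lemma top_monom_admissible j M : top_monom j M -> admissible j M.
Proof. by move=> Mj; apply/admissibleP=> i ji; rewrite Mj ltnNge ji. Qed.

Lemma sum_top_digits k :
  \sum_(i < n) (if i < k then p.-1 else 0) * p ^ i = (p ^ k).-1.
Proof.
have -> : \sum_(i < n) (if i < k then p.-1 else 0) * p ^ i =
          \sum_(i < n | i < k) p.-1 * p ^ i.
  by rewrite [RHS]big_mkcond; apply: eq_bigr => i _; case: ifP; rewrite ?mul0n.
by rewrite (big_ord_narrow (ltnW (ltn_ord k))) /= predn_exp big_distrr.
Qed.

Lemma digit_value_top j M : top_monom j M -> digit_value M = (p ^ j).-1.
Proof.
by move=> Mj; rewrite -sum_top_digits; apply: eq_bigr => i _; rewrite Mj.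
Qed.

Lemma digit_value_lt k A : admissible k A -> digit_value A < p ^ k.
Proof.
move=> /admissibleP Ak; have p_gt0 : 0 < p by apply: leq_ltn_trans (ltn_ord (A k)).
rewrite -[p ^ k]prednK ?expn_gt0 ?p_gt0 // ltnS -sum_top_digits.
apply: leq_sum => i _; rewrite leq_mul2r; apply/orP; right.
by have := ltn_ord (A i); have [/Ak ->|ik] := leqP k i; rewrite ?ik //; lia.
Qed.

Lemma digit_value_succ l A D :
  (forall i, A i = D i + (i == l) :> nat) ->
  digit_value A = digit_value D + p ^ l.
Proof.
move=> AD; rewrite /digit_value (eq_bigr (fun i => D i * p ^ i + (i == l) * p ^ i)).
  rewrite big_split /=; congr (_ + _).
  rewrite (bigD1 l) //= eqxx mul1n big1 ?addn0 // => i /negPf ->.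
  by rewrite mul0n.
by move=> i _; rewrite AD mulnDl.
Qed.

Lemma digit_value_add A B C : (forall i, A i + B i = C i) ->
  digit_value C = digit_value A + digit_value B.
Proof.
move=> ABC; rewrite -big_split; apply: eq_bigr => i _ /=.
by rewrite -ABC mulnDl.
Qed.

Lemma pdeg_weight k A : admissible k A ->
  pdeg A k = p ^ n.-1 - weight k A.
Proof.
move=> Ak; rewrite /pdeg.
have -> : \sum_(i < n | i < k) A i * p ^ i = digit_value A.
  rewrite [RHS](bigID (fun i : 'I_n => i < k)) /= [X in _ = _ + X]big1 ?addn0 // => i.
  by rewrite -leqNgt => /(admissibleP _ _ Ak) ->; rewrite mul0n.
have := digit_value_lt Ak; rewrite /weight.
have : p ^ k <= p ^ n.-1.
  rewrite leq_pexp2l ?(leq_ltn_trans _ (ltn_ord (A k))) //.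
  by have := ltn_ord k; lia.
lia.
Qed.

Lemma weight_gt0 k A : admissible k A -> 0 < weight k A.
Proof. by move=> /digit_value_lt; rewrite /weight subn_gt0. Qed.

Lemma weight_le k A : weight k A <= p ^ n.-1.
Proof.
apply: leq_trans (leq_subr _ _) _.
rewrite leq_pexp2l ?(leq_ltn_trans _ (ltn_ord (A k))) //.
by have := ltn_ord k; lia.
Qed.

Lemma weight_top j M : top_monom j M -> weight j M = 1.
Proof.
move=> Mj; have := digit_value_lt (top_monom_admissible Mj).
rewrite /weight (digit_value_top Mj); lia.
Qed.

(** The monomial of [x^A d_k, x^B d_l] is C = (A - e_l) + B, where D stands for
    A - e_l.  Its value is v(A) - p^l + v(B), whence the additivity of the
    weight; this is the whole source of the grading.  That x_l divides x^A is
    what makes l smaller than k. *)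
Lemma weight_bracket k l A B C D :
  admissible k A -> admissible l B ->
  (forall i, A i = D i + (i == l) :> nat) -> (forall i, D i + B i = C i) ->
  [/\ l < k, admissible k C & weight k C = weight k A + weight l B].
Proof.
move=> Ak Bl AD DBC.
have lk : l < k.
  rewrite ltnNge; apply/negP=> /(admissibleP _ _ Ak).
  by rewrite AD eqxx addn1.
split=> //.
  apply/admissibleP=> i ki; rewrite -DBC.
  have := admissibleP _ _ Ak i ki; rewrite AD (admissibleP _ _ Bl i); lia.
have := digit_value_lt Ak; have := digit_value_lt Bl.
rewrite /weight (digit_value_add DBC) (digit_value_succ AD); lia.
Qed.

Lemma first_index (P : pred 'I_n) : (exists i, P i) ->
  exists2 j, P j & forall i, i < j -> ~~ P i.
Proof.
move=> [i0 Pi0]; case: (arg_minnP (fun i : 'I_n => i : nat) Pi0) => j Pj jmin.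
by exists j => // i ij; apply/negP=> /jmin; rewrite leqNgt ij.
Qed.

(** Subtracting 1 from v(A): with j the first nonzero digit, the borrow turns the
    zeros below j into p - 1, which is what adding the top monomial M does to
    D = A - e_j. *)
Lemma lower_monom k A : admissible k A -> (exists i, A i != 0 :> nat) ->
  exists j M D C, [/\ j < k, top_monom j M,
    forall i, A i = D i + (i == j) :> nat & forall i, D i + M i = C i].
Proof.
move=> Ak /(first_index (P := fun i => A i != 0 :> nat))[j Aj0 Alt].
have ltA i : A i < p by apply: ltn_ord.
have [M Mj] : exists M, top_monom j M.
  by apply: monom_of_digits => i; have := ltA i; case: ifP; lia.
have [D DE] : exists D, forall i, D i = A i - (i == j) :> nat.
  by apply: monom_of_digits => i; have := ltA i; lia.
have [C CE] : exists C, forall i, C i = D i + M i :> nat.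
  apply: monom_of_digits => i; rewrite DE Mj; have := ltA i.
  by case: (ltnP i j) => [/Alt|_]; [rewrite negbK => /eqP -> |]; lia.
exists j, M, D, C; split=> // [|i].
  by rewrite ltnNge; apply: contra Aj0 => /(admissibleP _ _ Ak)/eqP.
by rewrite DE; case: (i =P j) => [->|_]; lia.
Qed.

(** Adding 1 to v(C), the inverse of [lower_monom]: j is the first digit of C
    other than p - 1.  It lies below k, for otherwise C would be the top
    monomial and would have weight 1. *)
Lemma raise_monom k C : admissible k C -> 1 < weight k C ->
  exists j M D A, [/\ j < k, top_monom j M,
    forall i, A i = D i + (i == j) :> nat & forall i, D i + M i = C i].
Proof.
move=> Ck wC; have ltC i : C i < p by apply: ltn_ord.
have : exists j : 'I_n, (j < k) && (C j < p.-1).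
  apply/existsP; apply: contraTT wC; rewrite negb_exists => /forallP Ctop.
  rewrite -leqNgt (@weight_top k C) // => i; have := Ctop i; have := ltC i.
  by have [/(admissibleP _ _ Ck) ->|ik] := leqP k i; rewrite ?ik //=; lia.
case/first_index=> j /andP[jk Cj] Clt.
have [M Mj] : exists M, top_monom j M.
  by apply: monom_of_digits => i; have := ltC i; case: ifP; lia.
have [D DE] : exists D, forall i, D i = C i - M i :> nat.
  by apply: monom_of_digits => i; have := ltC i; lia.
have [A AE] : exists A, forall i, A i = D i + (i == j) :> nat.
  apply: monom_of_digits => i; rewrite DE Mj; have := ltC i.
  by case: (i =P j) => [->|_]; lia.
exists j, M, D, A; split=> // i; rewrite DE Mj.
have := ltC i; case: (ltnP i j) => [ij|]; last lia.
by have := Clt i ij; rewrite (ltn_trans ij jk) /=; lia.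
Qed.
End Weights.

Local Open Scope ring_scope.

(** * The weight filtration and the two central series *)

Section Filtration.
Variables p n : nat.
Implicit Types (A B C D M : monom p n) (j k l : 'I_n) (u v : witt p n).
Implicit Types (S T : {set witt p n}).

Definition heavy (a : nat) k A := admissible k A && (a <= weight k A)%N.

Definition filt a : {set witt p n} :=
  spanset (\bigcup_k [set dterm (tmono A) k | A : monom p n & heavy a k A]).

Lemma filtP a u :
  reflect (forall k A, coef u k A != 0 -> heavy a k A) (u \in filt a).
Proof. exact: mem_spanset_monoP. Qed.

Lemma filt_dterm a k A : heavy a k A -> dterm (tmono A) k \in filt a.
Proof.
move=> hA; apply/filtP=> l B; rewrite coef_dterm.
by case: (l =P k) => [->|]; case: (B =P A) => [->|]; rewrite /= ?eqxx.
Qed.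

Lemma filt_coef0 a u k A : u \in filt a -> ~~ heavy a k A -> coef u k A = 0.
Proof. by move=> /filtP/(_ k A) ua; apply: contraNeq. Qed.

Lemma spanset_sub S T : (forall u, u \in S -> u \in spanset T) ->
  {subset spanset S <= spanset T}.
Proof.
move=> ST u; rewrite !inE; apply/subvP/span_subvP=> v.
by rewrite mem_enum => /ST; rewrite inE.
Qed.

(** A nonzero coefficient of the bracket at (k, C) comes from some product
    (d_l u_k) v_l or u_l (d_l v_k).  Both cases are instances of
    [weight_bracket], the roles of u and v being exchanged. *)
Lemma bracket_filt a b u v :
  u \in filt a -> v \in filt b -> bracket u v \in filt (a + b).
Proof.
move=> /filtP ua /filtP vb; apply/filtP=> k C; rewrite coef_bracket => nz.
have [l nzl] : exists l : 'I_n, (tmul (tderiv l (u k)) (v l) C : 'F_p) -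
            (tmul (u l) (tderiv l (v k)) C : 'F_p) != 0.
  apply/existsP; apply: contraNT nz; rewrite negb_exists => /forallP z.
  by rewrite big1 // => l _; apply/eqP/negPn/z.
have [/tmul_neq0[D [B [DBC /tderiv_neq0[A [AD uA]] vB]]] | z] :=
  boolP (tmul (tderiv l (u k)) (v l) C != 0).
  have /andP[Ak wA] := ua _ _ uA; have /andP[Bl wB] := vb _ _ vB.
  have [_ Ck wC] := weight_bracket Ak Bl AD DBC.
  by rewrite /heavy Ck wC leq_add.
have : tmul (u l) (tderiv l (v k)) C != 0.
  by apply: contraNneq nzl => ->; rewrite (eqP (negPn z)) subr0.
case/tmul_neq0=> [B [D [BDC uB /tderiv_neq0[A [AD vA]]]]].
have /andP[Ak wA] := vb _ _ vA; have /andP[Bl wB] := ua _ _ uB.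
have DBC i : (D i + B i = C i)%N by rewrite addnC.
have [_ Ck wC] := weight_bracket Ak Bl AD DBC.
by rewrite /heavy Ck wC addnC leq_add.
Qed.

Lemma heavy_top j M : top_monom j M -> heavy 1 j M.
Proof. by move=> Mj; rewrite /heavy top_monom_admissible // weight_top. Qed.

(** The bracket with x^M d_j contributes to a component k > j only
    through (d_j u_k) x^M; multiplication by x^M is injective on the monomials
    it does not kill, so a single coefficient of u is seen. *)
Lemma coef_bracket_lower u j k A D M C : (j < k)%N ->
  (forall i, A i = D i + (i == j) :> nat)%N -> (forall i, D i + M i = C i)%N ->
  coef (bracket u (dterm (tmono M) j)) k C = (A j)%:R * coef u k A.
Proof.
move=> jk AD DMC.
have kj : (k == j) = false by apply/negbTE; rewrite neq_ltn jk orbT.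
rewrite coef_bracket (bigD1 j isT) /= big1 ?addr0 => [|l /negPf lj];
  rewrite !dtermE kj tderiv0 tmul0r.
  by rewrite eqxx (tmul_mono_coef _ DMC) (tderiv_coef _ AD) ffunE subr0.
by rewrite lj tmul0r ffunE subr0.
Qed.

(** Here D = M - e_k.  The component j of the bracket is (d_j u_j) x^M minus the
    sum over l of u_l (d_l x^M).  The first part vanishes since u_j does not
    involve x_j; in the sum, a term with l <> k has an exponent of x_k at
    least M_k > D_k, and the term l = k sees only the constant coefficient of
    u_k. *)
Lemma coef_bracket_upper u j k A D M : u \in filt 1 -> j != k ->
  (forall i, M i = D i + (i == k) :> nat)%N -> (forall i, A i = 0 :> nat)%N ->
  coef (bracket u (dterm (tmono M) j)) j D = - ((M k)%:R * coef u k A).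
Proof.
move=> /filtP u1 jk MD A0.
have du l : tmul (tderiv l (u j)) (dterm (tmono M) j l) D = 0.
  apply/eqP/negPn/negP => /tmul_neq0[B [E [_ /tderiv_neq0[F [FB uF]]]]].
  rewrite dtermE; case: (l =P j) => [lj _|_]; last by rewrite ffunE eqxx.
  have /andP[Fj _] := u1 _ _ uF.
  by have := admissibleP _ _ Fj j (leqnn j); rewrite FB lj eqxx addn1.
rewrite coef_bracket (bigD1 k isT) /= big1 ?addr0 => [|l /negPf lk].
  rewrite du sub0r dtermE eqxx (tderiv_mono MD) tmul_scaler tpoly_scaleE.
  by rewrite (@tmul_mono_coef _ _ _ D A) // => i; rewrite A0.
rewrite du sub0r dtermE eqxx; apply/eqP; rewrite oppr_eq0.
apply/negPn/negP => /tmul_neq0[B [E [BED _ /tderiv_neq0[F [FE]]]]].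
rewrite ffunE; case: (F =P M) => [FM _|_]; last by rewrite eqxx.
have := FE k; rewrite FM MD eqxx eq_sym lk -BED; lia.
Qed.

Lemma lieL_filt : lieL p n = filt 1.
Proof.
apply/setP=> u; apply/mem_spanset_monoP/filtP => uP k A /uP.
  by move=> Ak; rewrite /heavy Ak weight_gt0.
by case/andP.
Qed.

Lemma xi_filt m : xi p n m = filt (p ^ n.-1 - m).+1.
Proof.
have E k A : admissible k A && (pdeg A k < m)%N = heavy (p ^ n.-1 - m).+1 k A.
  rewrite /heavy; case Ak: (admissible k A) => //=; rewrite pdeg_weight //.
  by have := weight_le k A; have := weight_gt0 Ak; lia.
by apply/setP=> u; apply/mem_spanset_monoP/filtP => uP k A /uP; rewrite E.
Qed.

Hypothesis p_prime : prime p.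

Lemma digit_neq0 A j : A j != 0 :> nat -> (A j)%:R != 0 :> 'F_p.
Proof.
move=> Aj0; rewrite -(dvdn_pcharf (pchar_Fp p_prime)); apply/negP=> /dvdn_leq.
by rewrite lt0n leqNgt ltn_ord => /(_ Aj0).
Qed.

(** A term of u of weight w < a would produce, by the bracket with a suitable
    weight 1 element, a nonzero coefficient of weight w + 1 <= a.  The bound on
    a is necessary: d_(n-1), of weight p^(n-1), is central. *)
Lemma filt_centralizer a u : (a <= p ^ n.-1)%N -> u \in filt 1 ->
  (forall v, v \in filt 1 -> bracket u v \in filt a.+1) -> u \in filt a.
Proof.
move=> aN u1 ua; apply/filtP=> k A uA.
have /andP[Ak _] := (filtP 1 u u1 _ _ uA).
rewrite /heavy Ak /= leqNgt; apply/negP=> wA.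
have [/existsP Anz|/existsPn A0] := boolP [exists i, A i != 0 :> nat].
  have [j [M [D [C [jk Mj AD DMC]]]]] := lower_monom Ak Anz.
  have [_ Ck wC] := weight_bracket Ak (top_monom_admissible Mj) AD DMC.
  have : coef (bracket u (dterm (tmono M) j)) k C = 0.
    apply/(filt_coef0 (ua _ (filt_dterm (heavy_top Mj)))).
    by rewrite /heavy Ck wC (weight_top Mj) addn1 /= -ltnNge ltnS.
  rewrite (coef_bracket_lower _ jk AD DMC) => /eqP; rewrite mulf_eq0.
  rewrite (negPf uA) orbF; apply/negP/digit_neq0.
  by rewrite AD eqxx addn1.
(* A = 0: no x_j can be lowered, so d_k has to act on the last v_j. *)
have {}A0 i : A i = 0 :> nat by apply/eqP/negPn/A0.
have p_gt1 := prime_gt1 p_prime.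
have wAk : weight k A = (p ^ k)%N.
  by rewrite /weight /digit_value big1 ?subn0 // => i _; rewrite A0.
have kn : (k < n.-1)%N.
  by rewrite -(ltn_exp2l _ _ p_gt1) -wAk (leq_trans wA).
have n1 : (n.-1 < n)%N by have := ltn_ord k; lia.
pose j := Ordinal n1.
have [M Mj] : exists M, top_monom j M.
  by apply: monom_of_digits => i; case: ifP => _; lia.
have [D DE] : exists D, forall i, D i = (M i - (i == k))%N :> nat.
  by apply: monom_of_digits => i; have := ltn_ord (M i); lia.
have MD i : M i = (D i + (i == k))%N :> nat.
  by rewrite DE; case: (i =P k) => [->|_]; rewrite ?Mj ?kn; lia.
have DAD i : (D i + A i = D i)%N by rewrite A0 addn0.
have [_ Dj wD] := weight_bracket (top_monom_admissible Mj) Ak MD DAD.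
have : coef (bracket u (dterm (tmono M) j)) j D = 0.
  apply/(filt_coef0 (ua _ (filt_dterm (heavy_top Mj)))).
  by rewrite /heavy Dj wD (weight_top Mj) add1n /= -ltnNge ltnS.
have jk : j != k by rewrite neq_ltn kn orbT.
rewrite (coef_bracket_upper u1 jk MD A0) => /eqP; rewrite oppr_eq0 mulf_eq0.
rewrite (negPf uA) orbF; apply/negP/digit_neq0.
by rewrite Mj kn -lt0n; lia.
Qed.

(** The inclusion from left to right is the grading.  Conversely [raise_monom]
    exhibits every basis element of weight at least a + 1 >= 2, up to the
    factor A_j, as a bracket with an element of weight 1. *)
Lemma lieprod_filt a : (0 < a)%N -> lieprod (filt a) (filt 1) = filt a.+1.
Proof.
move=> a_gt0; apply/setP=> w; apply/idP/idP; apply: spanset_sub => {}w.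
  by case/imset2P=> u v ua v1 ->; have := bracket_filt ua v1; rewrite (addn1 a).
case/bigcupP=> k _ /imsetP[C]; rewrite inE => /andP[Ck wC] ->.
have [j [M [D [A [jk Mj AD DMC]]]]] := raise_monom Ck (leq_ltn_trans a_gt0 wC).
have Ak : admissible k A.
  apply/admissibleP=> i ki; rewrite AD.
  have := admissibleP _ _ Ck i ki; rewrite -DMC.
  by case: (i =P j) => [ij|_]; [have := leq_trans jk ki; rewrite ij ltnn | lia].
have [_ _ wCA] := weight_bracket Ak (top_monom_admissible Mj) AD DMC.
have Aj : (A j)%:R != 0 :> 'F_p by apply: digit_neq0; rewrite AD eqxx addn1.
have Mk : M k = 0 :> nat by rewrite Mj ltnNge ltnW.
have -> : dterm (tmono C) k =
    (A j)%:R^-1 *: bracket (dterm (tmono A) k) (dterm (tmono M) j).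
  rewrite bracket_dterm (tderiv_mono AD) tmul_scalel (tmul_mono DMC).
  rewrite (tderiv_mono0 Mk) tmul0r dterm_scale.
  have -> : dterm 0 j = 0 :> witt p n by apply/ffunP=> i; rewrite dtermE ffunE if_same.
  by rewrite subr0 scalerA mulVf // scale1r.
rewrite inE; apply/memvZ/memv_span; rewrite mem_enum; apply: imset2_f.
  apply: filt_dterm; rewrite /heavy Ak -ltnS.
  by rewrite -(addn1 (weight k A)) -(weight_top Mj) -wCA.
exact/filt_dterm/heavy_top.
Qed.

Lemma lie_power_filt i : (0 < i)%N -> lie_power p n i = filt i.
Proof.
case: i => // i _; rewrite /lie_power /= lieL_filt.
by elim: i => //= i ->; rewrite lieprod_filt.
Qed.

Lemma upper_central_filt m : (m <= p ^ n.-1)%N ->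
  upper_central p n m = filt (p ^ n.-1 - m).+1.
Proof.
elim: m => [_|m IHm mN] /=.
  apply/setP=> u; rewrite inE; apply/eqP/idP => [->|/filtP u0].
    by apply/filtP=> k A; rewrite /coef !ffunE eqxx.
  apply/ffunP=> k; apply/ffunP=> A; rewrite !ffunE.
  apply/eqP/negPn/negP=> /u0/andP[_].
  by rewrite subn0 ltnNge weight_le.
rewrite (IHm (ltnW mN)) lieL_filt; set a := (p ^ n.-1 - m)%N.
have -> : (p ^ n.-1 - m.+1).+1 = a by rewrite subnSK.
apply/setP=> u; rewrite inE; apply/andP/idP.
  case=> u1 /forall_inP ua; apply: filt_centralizer => //.
  exact: leq_subr.
move=> ua; split; last first.
  by apply/forall_inP=> v v1; have := bracket_filt ua v1; rewrite (addn1 a).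
apply/filtP=> k A /(filtP a u ua)/andP[Ak wA]; rewrite /heavy Ak /=.
exact: weight_gt0.
Qed.
End Filtration.

Local Close Scope ring_scope.

Theorem corollary5p9 (p n m : nat) (p_prime : prime p) (p_odd : odd p)
    (n_ge1 : 1 <= n) (m_ge1 : 1 <= m) (m_le : m <= p ^ (n - 1)) :
  (forall i : 'I_n,
     xi p n m :&: basis_part p i = upper_central p n m :&: basis_part p i /\
     upper_central p n m :&: basis_part p i =
       lie_power p n (p ^ (n - 1) - m + 1) :&: basis_part p i) /\
  (xi p n m = upper_central p n m /\
   upper_central p n m = lie_power p n (p ^ (n - 1) - m + 1)).
Proof.
rewrite subn1 in m_le *.
have -> : upper_central p n m = xi p n m by rewrite upper_central_filt // xi_filt.
have -> : lie_power p n (p ^ n.-1 - m + 1) = xi p n m.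
  by rewrite addn1 lie_power_filt // xi_filt.
by [].
Qed.
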